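(* Let $W$ be a bounded weighted composition operator on $\ell^2(V)$, $(Wf)(w)=u(w) f(\psi(w))$. Then the following are equivalent: (1) $W$ is quasi-$\ast$-paranormal. (2) For every $f\in\ell^2(V)$, $$\sum_{w\in V}\left|\sum_{v\in chi(w)}|u(v)|^2\right|^2|f(w)|^2 \leq \left(\sum_{w\in V}|u_3(w)|^2|f(\psi^3(w))|^2\right)^{1/2}\left(\sum_{w\in V}|u_1(w)|^2|f(\psi(w))|^2\right)^{1/2}.$$ (3) For every $k\ge 0$ and every $f\in\ell^2(V)$, $$\sum_{w\in V}\left(\sum_{v \in \psi^{-3}(w)}|u_3(v)|^2-2k \Big(\sum_{v_1\in \psi^{-1}(w)}|u(v_1)|^2\Big)^2+k^2 \sum_{v_1\in \psi^{-1}(w)}|u(v_1)|^2 \right)|f(w)|^2 \geq 0.$$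
   Context: $(V,E)$ is a directed graph in which every vertex $v$ has exactly one parent $\psi(v)=par(v)$, so $\psi:V\to V$; $chi(w)=\psi^{-1}(w)=\{v\in V:\psi(v)=w\}$ is the set of children of $w$, and $\psi^{-n}(w)=\{v\in V:\psi^n(v)=w\}$. $u:V\to\mathbb{C}$ is a function and $u_n=u\cdot (u\circ\psi)\cdots(u\circ\psi^{n-1})$, so $u_1=u$. $\ell^2(V)$ is the Hilbert space of square summable complex functions on $V$. A bounded operator $T$ on a Hilbert space $\mathcal{H}$ is quasi-$\ast$-paranormal if $\|T^*Tx\|^2\le\|T^3x\|\,\|Tx\|$ for all $x\in\mathcal{H}$. *)

(* Defs.v *)
From HB Require Import structures.
From mathcomp Require Import all_boot all_order all_algebra.
From mathcomp Require Import sesquilinear complex.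
From mathcomp Require Import ring lra.
From mathcomp Require Import all_classical all_reals.
From mathcomp Require Import ereal numfun esum.

Set Implicit Arguments.
Unset Strict Implicit.
Unset Printing Implicit Defensive.

Import Order.TTheory GRing.Theory Num.Theory.
Import ComplexField.Normc.

Local Open Scope classical_set_scope.
Local Open Scope ring_scope.
Local Open Scope complex_scope.

Reserved Notation "\rsum_ ( i 'in' D ) F"
  (at level 41, F at level 41, i, D at level 50,
   format "\rsum_ ( i  'in'  D )  F").
Reserved Notation "\csum_ ( i 'in' D ) F"
  (at level 41, F at level 41, i, D at level 50,
   format "\csum_ ( i  'in'  D )  F").

(* [esum] is only meaningful for nonnegative families, so a real family is
   split into its positive and negative parts. For an absolutely summable
   family this is its unordered sum; an infinite part counts as 0, so the
   value is meaningless when the family is not absolutely summable. *)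
Definition rsum (R : realType) (I : choiceType) (D : set I) (a : I -> R) : R :=
  fine (\esum_(i in D) (a^\+ i)%:E) - fine (\esum_(i in D) (a^\- i)%:E).

Notation "\rsum_ ( i 'in' D ) F" := (rsum D (fun i => F)) : ring_scope.

Definition csum (R : realType) (I : choiceType) (D : set I) (a : I -> R[i]) :
  R[i] := (\rsum_(i in D) complex.Re (a i)) +i* (\rsum_(i in D) complex.Im (a i)).

Notation "\csum_ ( i 'in' D ) F" := (csum D (fun i => F)) : ring_scope.

Section rsum_theory.
Variables (R : realType) (I : choiceType) (D : set I).
Implicit Types a b : I -> R.

Lemma esumZl (c : R) (e : I -> \bar R) : 0 <= c -> (forall i, 0 <= e i)%E ->
  (\esum_(i in D) (c%:E * e i) = c%:E * \esum_(i in D) e i)%E.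
Proof.
move=> c0 e0; rewrite /esum -ereal_supZl//; last first.
  by apply/set0P; exists (\sum_(x \in set0) e x)%E, set0 => //; exact: fsets_set0.
congr ereal_sup; rewrite image_comp; apply: eq_imagel => A _ /=.
by rewrite ge0_mule_fsumr.
Qed.

Lemma rsum_ge0 a : (forall i, D i -> 0 <= a i) ->
  \rsum_(i in D) a i = fine (\esum_(i in D) (a i)%:E).
Proof.
move=> a0; rewrite /rsum [X in _ - fine X]esum1 ?subr0; last first.
  by move=> i Di; rewrite (ge0_funrnegE a0)// inE.
by congr fine; apply: eq_esum => i Di; rewrite (ge0_funrposE a0)// inE.
Qed.

Lemma rsumN a : \rsum_(i in D) (- a i) = - \rsum_(i in D) a i.
Proof.
by rewrite -[fun i => - a i]/(\- a) /rsum funrposN funrnegN opprB.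
Qed.

Definition rsummable a := summable D (EFin \o a).

Lemma rsummable_le a b : (forall i, D i -> `|a i| <= b i) ->
  rsummable b -> rsummable a.
Proof.
move=> ab; apply: le_lt_trans; apply: le_esum => i Di /=.
by rewrite lee_fin (le_trans (ab _ Di))// ler_norm.
Qed.

Lemma rsummableD a b : rsummable a -> rsummable b ->
  rsummable (fun i => a i + b i).
Proof. by move=> sa sb; exact: (summableD sa sb). Qed.

Lemma rsummable_pos a : rsummable a -> rsummable a^\+.
Proof. by move=> /summable_funepos; rewrite funerpos. Qed.

Lemma rsummable_neg a : rsummable a -> rsummable a^\-.
Proof. by move=> /summable_funeneg; rewrite funerneg. Qed.

Lemma rsummable_fin a : (forall i, 0 <= a i) -> rsummable a ->
  (\esum_(i in D) (a i)%:E \is a fin_num)%E.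
Proof.
move=> a0; rewrite /rsummable summableE => h.
by rewrite (eq_esum (b := fun i => `|(EFin \o a) i|%E))// => i _ /=; rewrite ger0_norm.
Qed.

Lemma rsumB a b : (forall i, 0 <= a i) -> (forall i, 0 <= b i) ->
  rsummable a -> rsummable b ->
  \rsum_(i in D) (a i - b i) =
  fine (\esum_(i in D) (a i)%:E) - fine (\esum_(i in D) (b i)%:E).
Proof.
move=> a0 b0 sa sb; set c := fun i => a i - b i.
have sc : rsummable c by exact: (summableB sa sb).
have sp := rsummable_pos sc; have sn := rsummable_neg sc.
have : (\esum_(i in D) (c^\+ i)%:E + \esum_(i in D) (b i)%:E =
        \esum_(i in D) (c^\- i)%:E + \esum_(i in D) (a i)%:E)%E.
  rewrite -!esumD//; [|by move=> i _; rewrite lee_fin..].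
  apply: eq_esum => i _; rewrite -!EFinD; congr EFin.
  have h : c^\+ i - c^\- i = a i - b i by exact: (congr1 (@^~ i) (funrposBneg c)).
  by move: h; move: (c^\+ i) (c^\- i) => x y; lra.
move=> /(congr1 fine); rewrite !fineD ?rsummable_fin// /rsum.
by rewrite -/c; lra.
Qed.

Lemma rsumD a b : rsummable a -> rsummable b ->
  \rsum_(i in D) (a i + b i) = \rsum_(i in D) a i + \rsum_(i in D) b i.
Proof.
move=> sa sb.
have [sap san] := (rsummable_pos sa, rsummable_neg sa).
have [sbp sbn] := (rsummable_pos sb, rsummable_neg sb).
have -> : (fun i => a i + b i) =
    (fun i => (a^\+ i + b^\+ i) - (a^\- i + b^\- i)).
  apply/funext => i; rewrite -{1}(funrposBneg a) -{1}(funrposBneg b) /=.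
  by rewrite opprD addrACA.
rewrite rsumB; try (by move=> i; rewrite addr_ge0); try exact: rsummableD.
under eq_esum do rewrite EFinD.
rewrite esumD//; [|by move=> i _; rewrite lee_fin..].
under [X in _ - fine X]eq_esum do rewrite EFinD.
rewrite [X in _ - fine X]esumD//; [|by move=> i _; rewrite lee_fin..].
by rewrite !fineD ?rsummable_fin// opprD addrACA.
Qed.

Lemma rsumZ (c : R) a : \rsum_(i in D) (c * a i) = c * \rsum_(i in D) a i.
Proof.
have ge0 (d : R) b : 0 <= d ->
    \rsum_(i in D) (d * b i) = d * \rsum_(i in D) b i.
  move=> d0; rewrite /rsum ge0_funrposM// ge0_funrnegM//.
  under eq_esum do rewrite EFinM.
  under [X in _ - fine X]eq_esum do rewrite EFinM.
  have fineZ (x : \bar R) : fine (d%:E * x)%E = d * fine x.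
    have [->|dn0] := eqVneq d 0; first by rewrite mul0e mul0r.
    case: x => [x| |] //=; rewrite mulr0.
      by rewrite gt0_muley// lte_fin lt_neqAle eq_sym dn0.
    by rewrite gt0_muleNy// lte_fin lt_neqAle eq_sym dn0.
  by rewrite !esumZl ?fineZ ?mulrBr// => i; rewrite lee_fin.
have [c0|/ltW c0] := leP 0 c; first exact: ge0.
rewrite -[RHS]opprK -mulNr -ge0 ?oppr_ge0// -rsumN.
by congr rsum; apply/funext => i; rewrite mulNr opprK.
Qed.

Lemma rsummableZ (c : R) a : rsummable a -> rsummable (fun i => c * a i).
Proof.
rewrite /rsummable /summable => sa.
rewrite (eq_esum (b := fun i => `|c|%:E * `|(EFin \o a) i|))%E; last first.
  by move=> i _ /=; rewrite normrM EFinM.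
by rewrite esumZl// lte_mul_pinfty.
Qed.

End rsum_theory.

Section ell2_def.
Variables (R : realType) (V : choiceType).

Definition square_summable : {pred V -> R[i]} :=
  mem [set f : V -> R[i] | (\esum_(v in setT) (normc (f v) ^+ 2)%:E < +oo)%E].

Record ell2 : Type := Ell2 {
  ell2_fun :> V -> R[i];
  ell2P : ell2_fun \in square_summable
}.

HB.instance Definition _ := [isSub for ell2_fun].
HB.instance Definition _ := [Choice of ell2 by <:].

Lemma normc_sqrD (x y : R[i]) :
  normc (x + y) ^+ 2 <= 2 * normc x ^+ 2 + 2 * normc y ^+ 2.
Proof.
case: x y => [a b] [c d] /=; rewrite !sqr_sqrtr ?addr_ge0 ?sqr_ge0//.
rewrite -subr_ge0 [leRHS](_ : _ = (a - c) ^+ 2 + (b - d) ^+ 2).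
  by rewrite addr_ge0 ?sqr_ge0.
by rewrite !sqrrD !sqrrN; ring.
Qed.

Lemma square_summable_submod_closed : submod_closed square_summable.
Proof.
split=> [|a f g]; rewrite !inE /=.
  by rewrite esum1// => v _; rewrite /= expr0n addr0 sqrtr0 expr0n.
move=> fs gs.
pose k := 2 * normc a ^+ 2.
have h v : ((normc (a * f v + g v) ^+ 2)%:E <=
    k%:E * (normc (f v) ^+ 2)%:E + 2%:E * (normc (g v) ^+ 2)%:E)%E.
  rewrite -!EFinM -EFinD lee_fin (le_trans (normc_sqrD _ _))//.
  by rewrite normcM exprMn mulrA.
apply: (le_lt_trans (le_esum (fun v _ => h v))).
have k0 : 0 <= k by rewrite mulr_ge0 ?sqr_ge0.
rewrite esumD; try by move=> v _; rewrite -EFinM lee_fin mulr_ge0 ?sqr_ge0.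
rewrite !esumZl//; try by move=> v; rewrite lee_fin sqr_ge0.
by rewrite lte_add_pinfty// lte_mul_pinfty.
Qed.

HB.instance Definition _ := GRing.isSubmodClosed.Build _ _ square_summable
  square_summable_submod_closed.
HB.instance Definition _ := [SubChoice_isSubLmodule of ell2 by <:].

Definition ell2_dot (f g : ell2) : R[i] := \csum_(v in setT) (f v * (g v)^*).

Definition csummable (I : choiceType) (D : set I) (a : I -> R[i]) :=
  rsummable D (fun i => complex.Re (a i)) /\
  rsummable D (fun i => complex.Im (a i)).

Lemma csumP (I : choiceType) (D : set I) (c : R[i]) (a b : I -> R[i]) :
  csummable D a -> csummable D b ->
  \csum_(i in D) (c * a i + b i) =
  c * (\csum_(i in D) a i) + \csum_(i in D) b i.
Proof.
move=> [ra ia] [rb ib]; case: c => x y.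
have E1 i : complex.Re ((x +i* y) * a i + b i) =
    (x * complex.Re (a i) + (- y) * complex.Im (a i)) + complex.Re (b i).
  by case: (a i) => ? ?; case: (b i) => ? ? /=; rewrite mulNr.
have E2 i : complex.Im ((x +i* y) * a i + b i) =
    (x * complex.Im (a i) + y * complex.Re (a i)) + complex.Im (b i).
  by case: (a i) => ? ?; case: (b i) => ? ? /=.
have rsumP (s t : R) (p q r : I -> R) :
    rsummable D p -> rsummable D q -> rsummable D r ->
    \rsum_(i in D) ((s * p i + t * q i) + r i) =
    s * (\rsum_(i in D) p i) + t * (\rsum_(i in D) q i) + \rsum_(i in D) r i.
  move=> sp sq sr.
  have sp' := rsummableZ s sp; have sq' := rsummableZ t sq.
  by rewrite (rsumD (rsummableD sp' sq') sr) (rsumD sp' sq') !rsumZ.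
apply/eqP; rewrite eq_complex; apply/andP; split; apply/eqP.
- rewrite [LHS](_ : _ = \rsum_(i in D)
      ((x * complex.Re (a i) + (- y) * complex.Im (a i)) + complex.Re (b i))).
    by rewrite rsumP// mulNr.
  by congr rsum; apply/funext.
- rewrite [LHS](_ : _ = \rsum_(i in D)
      ((x * complex.Im (a i) + y * complex.Re (a i)) + complex.Im (b i))).
    by rewrite rsumP.
  by congr rsum; apply/funext.
Qed.

Lemma csum_conj (I : choiceType) (D : set I) (a : I -> R[i]) :
  \csum_(i in D) (a i)^* = (\csum_(i in D) a i)^*.
Proof.
rewrite /csum /= -rsumN; congr Complex; congr rsum.
  by apply/funext => i; case: (a i).
by apply/funext => i; case: (a i).
Qed.

Lemma ell2_rsummable (f : ell2) : rsummable setT (fun v => normc (f v) ^+ 2).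
Proof.
have := ell2P f; rewrite inE /=; apply: le_lt_trans; apply: le_esum => v _ /=.
by rewrite ger0_norm ?sqr_ge0.
Qed.

Lemma ell2_csummable (f g : ell2) : csummable setT (fun v => f v * (g v)^*).
Proof.
have s := rsummableD (ell2_rsummable f) (ell2_rsummable g).
by split; apply: rsummable_le s => v _;
  case: (f v) (g v) => [a b] [c d] /=;
  rewrite !sqr_sqrtr ?addr_ge0 ?sqr_ge0// ler_norml; apply/andP; split;
  have := (sqr_ge0 (a + c), sqr_ge0 (a - c), sqr_ge0 (b + d), sqr_ge0 (b - d),
           sqr_ge0 (a + d), sqr_ge0 (a - d), sqr_ge0 (b + c), sqr_ge0 (b - c));
  move=> [[[[[[[]]]]]]]; have := (sqr_ge0 a, sqr_ge0 b, sqr_ge0 c, sqr_ge0 d);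
  move=> [[[]]]; nra.
Qed.

Lemma ell2_dotC (f g : ell2) : ell2_dot f g = Num.conj (ell2_dot g f).
Proof.
rewrite -[RHS]csum_conj; congr csum; apply/funext => v.
by case: (f v) (g v) => [a b] [c d]; simpc; congr Complex; ring.
Qed.

Lemma ell2_dotPl (h : ell2) : GRing.linear_for *%R (ell2_dot ^~ h).
Proof.
move=> a f g; rewrite /ell2_dot -csumP; try exact: ell2_csummable.
by congr csum; apply/funext => v; rewrite mulrDl mulrA.
Qed.

Lemma ell2_dotPr (h : ell2) : GRing.linear_for (Num.conj \; *%R) (ell2_dot h).
Proof.
move=> a f g; rewrite ell2_dotC ell2_dotPl rmorphD rmorphM /=.
by rewrite -!ell2_dotC.
Qed.

HB.instance Definition _ := bilinear_isBilinear.Build R[i] ell2 ell2 R[i]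
  *%R (Num.conj \; *%R) ell2_dot (ell2_dotPl, ell2_dotPr).

Lemma ell2_dot_herm (f g : ell2) :
  ell2_dot f g = (-1) ^+ false * Num.conj (ell2_dot g f).
Proof. by rewrite mul1r -ell2_dotC. Qed.

HB.instance Definition _ :=
  isHermitianSesquilinear.Build R[i] ell2 false Num.conj ell2_dot ell2_dot_herm.

Lemma ell2_dotE (f : ell2) :
  ell2_dot f f = (\rsum_(v in setT) normc (f v) ^+ 2)%:C.
Proof.
rewrite /ell2_dot /csum; congr Complex.
  by congr rsum; apply/funext => v; case: (f v) => a b /=;
    rewrite sqr_sqrtr ?addr_ge0 ?sqr_ge0//; ring.
rewrite (_ : (fun _ => _) = fun v => 0 * 0); first by rewrite rsumZ mul0r.
by apply/funext => v; case: (f v) => a b /=; ring.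
Qed.

Lemma ell2_dot_gt0 (f : ell2) : f != 0 -> 0 < ell2_dot f f.
Proof.
move=> f0; rewrite ell2_dotE ltcR.
have [v fv0] : exists v, f v != 0.
  apply/not_existsP => h; move/eqP: f0; apply; apply: val_inj; apply/funext => v.
  by apply/eqP/negPn/negP/h.
rewrite rsum_ge0; last by move=> i _; rewrite sqr_ge0.
have fin := rsummable_fin (fun v => sqr_ge0 _) (ell2_rsummable f).
rewrite -lte_fin fineK//.
apply: (@lt_le_trans _ _ (normc (f v) ^+ 2)%:E).
  rewrite lte_fin exprn_gt0// lt_neqAle eq_sym; apply/andP; split.
    by apply: contra fv0 => /eqP/eq0_normc/eqP.
  by case: (f v) => a b /=; rewrite sqrtr_ge0.
rewrite -(@esum_set1 _ _ v (fun v => (normc (f v) ^+ 2)%:E)); last first.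
  by rewrite lee_fin sqr_ge0.
rewrite esum_mkcond [leRHS]esum_mkcond; apply: le_esum => i _.
by rewrite in_setT; case: ifP => // _; rewrite lee_fin sqr_ge0.
Qed.

HB.instance Definition _ := isDotProduct.Build R[i] ell2 ell2_dot ell2_dot_gt0.

End ell2_def.

Section operators.
Variables (R : realType) (H : lmodType R[i]) (dot : {dot H for Num.conj}).
Implicit Types T S : H -> H.

Definition hnorm (x : H) : R := Num.sqrt (complex.Re (dot x x)).

Definition bounded_operator (T : {linear H -> H}) : Prop :=
  exists M : R, forall x, hnorm (T x) <= M * hnorm x.

Definition is_adjoint T S : Prop := forall x y, dot (T x) y = dot x (S y).

Lemma is_adjoint_unique T S1 S2 :
  is_adjoint T S1 -> is_adjoint T S2 -> S1 =1 S2.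
Proof.
move=> h1 h2 y; apply/eqP; rewrite -subr_eq0; apply/negPn/negP.
move=> /(@neq0_dnorm_gt0 _ _ _ dot).
set z := S1 y - S2 y.
have -> : dot z z = dot z (S1 y) - dot z (S2 y) by exact: linearBr.
by rewrite -h1 -h2 subrr ltxx.
Qed.

(* On a Hilbert space a bounded operator has exactly one adjoint, and that
   adjoint is linear and bounded. *)
Definition quasi_star_paranormal T : Prop :=
  exists2 Tstar : H -> H, is_adjoint T Tstar &
    forall x, hnorm (Tstar (T x)) ^+ 2 <= hnorm (T (T (T x))) * hnorm (T x).

End operators.

Section weighted_composition_def.
Variables (R : realType) (V : choiceType).
Implicit Types (E : V -> V -> Prop) (psi : V -> V) (u : V -> R[i]).

(* [E w v] is an edge from the parent [w] to its child [v]. *)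
Definition parent_map E psi : Prop := forall v w, E w v <-> w = psi v.

Definition iter_preimage psi n (w : V) : set V := [set v | iter n psi v = w].

Definition chi psi (w : V) : set V := psi @^-1` [set w].

Definition u_ u psi n (v : V) : R[i] := \prod_(i < n) u (iter i psi v).

Definition weighted_composition u psi (W : ell2 R V -> ell2 R V) : Prop :=
  forall f w, W f w = u w * f (psi w).

End weighted_composition_def.

(* Main.v *)
Require Import Defs.
From HB Require Import structures.
From mathcomp Require Import all_boot all_order all_algebra.
From mathcomp Require Import sesquilinear complex.
From mathcomp Require Import ring lra.
From mathcomp Require Import all_classical all_reals.
From mathcomp Require Import ereal numfun esum.

Set Implicit Arguments.
Unset Strict Implicit.

Import Order.TTheory GRing.Theory Num.Theory.
Import ComplexField.Normc.

Local Open Scope classical_set_scope.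
Local Open Scope ring_scope.
Local Open Scope complex_scope.

(** Since [<W^* W f, delta_w> = <W f, W delta_w>], the operator [W^* W] is
    multiplication by [m1 w = sum_(v in chi w) |u v|^2], while summing over the
    fibres of [psi] and [psi^3] gives [|W f|^2 = sum m1 |f|^2] and
    [|W^3 f|^2 = sum m3 |f|^2], with [m3] the weight of the third preimage.
    This turns (1) into (2), and (3) says that a quadratic polynomial in [k] is
    nonnegative on [k >= 0], which is the discriminant form of (2) for each
    fixed [f]. The adjoint exists as [(W^* g) w = <g, W delta_w>]; it is square
    summable by Cauchy-Schwarz on each fibre, as [|W delta_w|] is bounded. *)

(** * Unordered sums of real and complex families *)

Section summation.
Context {R : realType} {I : choiceType}.
Implicit Types (D : set I) (a b : I -> R).

Lemma rsummable_fine_esum D a : (forall i, 0 <= a i) -> rsummable D a ->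
  (\esum_(i in D) (a i)%:E = (\rsum_(i in D) a i)%:E)%E.
Proof. by move=> a0 sa; rewrite rsum_ge0// fineK// rsummable_fin. Qed.

Lemma esum_ltey_rsummable D a : (forall i, 0 <= a i) ->
  (\esum_(i in D) (a i)%:E < +oo)%E -> rsummable D a.
Proof.
move=> a0; rewrite /rsummable /summable; under [X in _ -> (X < _)%E]eq_esum.
  by move=> i _ /=; rewrite ger0_norm//; over.
by [].
Qed.

Lemma eq_rsum D a b : {in D, a =1 b} ->
  \rsum_(i in D) a i = \rsum_(i in D) b i.
Proof.
move=> ab; rewrite /rsum; congr (fine _ - fine _); apply: eq_esum => i Di.
  by rewrite /funrpos ab ?inE.
by rewrite /funrneg ab ?inE.
Qed.

Lemma rsum_mkcond D a :
  \rsum_(i in D) a i = \rsum_(i in setT) (if i \in D then a i else 0).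
Proof.
rewrite /rsum esum_mkcond [X in _ - fine X]esum_mkcond.
congr (fine _ - fine _); apply: eq_esum => i _; rewrite /funrpos /funrneg.
  by case: ifP => // _; rewrite maxxx.
by case: ifP => // _; rewrite oppr0 maxxx.
Qed.

Lemma rsummable_sub D a : rsummable setT a -> rsummable D a.
Proof.
apply: le_lt_trans; rewrite esum_mkcond; apply: le_esum => i _.
by case: ifP.
Qed.

Lemma rsum_nonneg D a : (forall i, D i -> 0 <= a i) -> 0 <= \rsum_(i in D) a i.
Proof.
by move=> a0; rewrite rsum_ge0// fine_ge0// esum_ge0// => i /a0; rewrite lee_fin.
Qed.

Lemma csum_mkcond D (a : I -> R[i]) :
  \csum_(i in D) a i = \csum_(i in setT) (if i \in D then a i else 0).
Proof.
rewrite /csum rsum_mkcond [X in _ +i* X]rsum_mkcond; congr Complex.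
  by apply: eq_rsum => i _; case: ifP.
by apply: eq_rsum => i _; case: ifP.
Qed.

Lemma eq_csum D (a b : I -> R[i]) : {in D, a =1 b} ->
  \csum_(i in D) a i = \csum_(i in D) b i.
Proof. by move=> ab; congr Complex; apply: eq_rsum => i /ab ->. Qed.

Lemma csumZr D (a : I -> R) (z : R[i]) :
  \csum_(i in D) ((a i)%:C * z) = (\rsum_(i in D) a i)%:C * z.
Proof.
case: z => x y; rewrite /csum; simpc; congr Complex.
  by rewrite mulrC -rsumZ; apply: eq_rsum => i _ /=; ring.
by rewrite mulrC -rsumZ; apply: eq_rsum => i _ /=; ring.
Qed.

End summation.

(** * Summation along the fibres of a map *)

Section fibres.
Context {R : realType} {I J : choiceType} (phi : I -> J).
Implicit Types (D : set I) (a : I -> R).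

(** The double sum runs over the pairs [(j, i)] with [phi i = j], and [i] corresponds bijectively to
    the pair [(phi i, i)]. *)
Lemma esum_fibre (e : I -> \bar R) : (forall i, 0 <= e i)%E ->
  (\esum_(i in setT) e i =
   \esum_(j in setT) \esum_(i in phi @^-1` [set j]) e i)%E.
Proof.
move=> e0; rewrite esum_esum//; apply: reindex_esum => //; split=> //.
- by move=> [j i] [j' i'] /[!inE] -[_ /= <-] [_ /= <-] ->.
- by move=> i _; exists (phi i, i).
Qed.

Let rsummable_fibre0 a : (forall i, 0 <= a i) -> rsummable setT a ->
  rsummable setT (fun j => \rsum_(i in phi @^-1` [set j]) a i).
Proof.
move=> a0 sa; apply: esum_ltey_rsummable => [j|]; first exact: rsum_nonneg.
rewrite [ltLHS](_ : _ = \esum_(i in setT) (a i)%:E)%E; last first.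
  rewrite (@esum_fibre (fun i => (a i)%:E))//.
  by apply: eq_esum => j _; rewrite rsummable_fine_esum//; exact: rsummable_sub.
by rewrite rsummable_fine_esum// ltey.
Qed.

Let rsum_fibre0 a : (forall i, 0 <= a i) -> rsummable setT a ->
  \rsum_(i in setT) a i =
  \rsum_(j in setT) \rsum_(i in phi @^-1` [set j]) a i.
Proof.
move=> a0 sa; rewrite rsum_ge0// rsum_ge0; last by move=> j _; exact: rsum_nonneg.
congr fine; rewrite esum_fibre//; apply: eq_esum => j _.
by rewrite rsummable_fine_esum//; exact: rsummable_sub.
Qed.

Let rsum_posneg D a :
  \rsum_(i in D) a i = \rsum_(i in D) a^\+ i - \rsum_(i in D) a^\- i.
Proof. by rewrite [X in _ = X - _]rsum_ge0// [X in _ = _ - X]rsum_ge0. Qed.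

(** Each fibre sum is the difference of the fibre sums of [a^\+] and [a^\-], and both of these
    families are summable by the nonnegative case. *)
Lemma rsummable_fibre a : rsummable setT a ->
  rsummable setT (fun j => \rsum_(i in phi @^-1` [set j]) a i).
Proof.
move=> sa.
have sp := rsummable_fibre0 (funrpos_ge0 a) (rsummable_pos sa).
have sn := rsummable_fibre0 (funrneg_ge0 a) (rsummable_neg sa).
rewrite (_ : (fun j => _) = (fun j => \rsum_(i in phi @^-1` [set j]) a^\+ i
    + - 1 * \rsum_(i in phi @^-1` [set j]) a^\- i)).
  by apply: rsummableD => //; exact: rsummableZ.
by apply/funext => j; rewrite mulN1r rsum_posneg.
Qed.

(** The signed version is needed because inner products, unlike norms, are sums of terms without a
    sign; it follows from the nonnegative case applied to [a^\+] and [a^\-]. *)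
Lemma rsum_fibre a : rsummable setT a ->
  \rsum_(i in setT) a i =
  \rsum_(j in setT) \rsum_(i in phi @^-1` [set j]) a i.
Proof.
move=> sa.
have sp := rsummable_fibre0 (funrpos_ge0 a) (rsummable_pos sa).
have sn := rsummable_fibre0 (funrneg_ge0 a) (rsummable_neg sa).
rewrite rsum_posneg (rsum_fibre0 (funrpos_ge0 a))//; last exact: rsummable_pos.
rewrite (rsum_fibre0 (funrneg_ge0 a))//; last exact: rsummable_neg.
rewrite -rsumN -rsumD//; last first.
  by rewrite (_ : (fun _ => _) = (fun j => - 1 *
    \rsum_(i in phi @^-1` [set j]) a^\- i)); [exact: rsummableZ|
    apply/funext => j; rewrite mulN1r].
by apply: eq_rsum => j _; rewrite [RHS]rsum_posneg.
Qed.

Lemma csum_fibre (a : I -> R[i]) : csummable setT a ->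
  \csum_(i in setT) a i =
  \csum_(j in setT) \csum_(i in phi @^-1` [set j]) a i.
Proof. by move=> [sr si]; rewrite /csum /= -!rsum_fibre. Qed.

End fibres.

(** * Restrictions, point masses and Cauchy-Schwarz in [ell2] *)

Section ell2_space.
Context {R : realType} {V : choiceType}.
Implicit Types (f g x y : ell2 R V) (D : set V).

Local Notation dot := (@ell2_dot R V).

Lemma square_summable_le (h : V -> R[i]) (b : V -> R) :
  (forall v, normc (h v) ^+ 2 <= b v) -> rsummable setT b ->
  h \in @square_summable R V.
Proof.
move=> hb sb; rewrite inE; apply: le_lt_trans sb; apply: le_esum => v _.
by rewrite lee_fin (le_trans (hb v))// ler_norm.
Qed.

Lemma ell2_restrict_subproof D f :
  (fun v => if v \in D then f v else 0) \in @square_summable R V.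
Proof.
apply: square_summable_le (ell2_rsummable f) => v.
by case: ifP => //; rewrite normc0 expr0n sqr_ge0.
Qed.

(** Used with [D] a fibre, so that Cauchy-Schwarz only sees the part of the norm of [f] carried by
    that fibre. *)
Definition ell2_restrict D f : ell2 R V := Ell2 (ell2_restrict_subproof D f).

Lemma ell2_delta_subproof (w : V) :
  (fun v => (v == w)%:R : R[i]) \in @square_summable R V.
Proof.
rewrite inE /= (_ : (\esum_(v in setT) _)%E =
    \esum_(v in [set w]) (normc (v == w)%:R ^+ 2)%:E)%E.
  by rewrite esum_set1 ?ltry// lee_fin sqr_ge0.
rewrite [RHS]esum_mkcond; apply: eq_esum => v _; rewrite in_set1.
by case: eqP => // _; rewrite normc0 expr0n.
Qed.

Definition ell2_delta (w : V) : ell2 R V := Ell2 (ell2_delta_subproof w).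

Lemma hnorm_ge0 x : 0 <= hnorm dot x.
Proof. exact: sqrtr_ge0. Qed.

Lemma hnormE x : hnorm dot x = Num.sqrt (\rsum_(v in setT) normc (x v) ^+ 2).
Proof. by congr Num.sqrt; exact: (congr1 (@complex.Re R) (ell2_dotE x)). Qed.

Lemma sqr_hnorm x : hnorm dot x ^+ 2 = \rsum_(v in setT) normc (x v) ^+ 2.
Proof. by rewrite hnormE sqr_sqrtr// rsum_nonneg// => v _; exact: sqr_ge0. Qed.

Lemma ell2_dot_normE x : dot x x = (hnorm dot x ^+ 2)%:C.
Proof. by rewrite ell2_dotE sqr_hnorm. Qed.

Lemma ell2_CauchySchwarz x y :
  normc (dot x y) ^+ 2 <= hnorm dot x ^+ 2 * hnorm dot y ^+ 2.
Proof.
have [->|y0] := eqVneq y 0.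
  by rewrite (linear0r dot) normc0 expr0n mulr_ge0 ?sqr_ge0.
have dy : 0 < hnorm dot y ^+ 2.
  by rewrite -ltcR -ell2_dot_normE; exact: ell2_dot_gt0.
(* [|G x - c y|^2 = G (G |x|^2 - |c|^2)] for [G = <y, y>] and [c = <x, y>]. *)
have h : 0 <= dot (dot y y *: x - dot x y *: y) (dot y y *: x - dot x y *: y).
  by rewrite ell2_dot_normE lecR sqr_ge0.
rewrite linearBl !linearBr !linearZl_LR !linearZr_LR /= in h.
move: h dy; rewrite (ell2_dotC y x) !ell2_dot_normE.
move: (hnorm dot x ^+ 2) (hnorm dot y ^+ 2) (dot x y) => X Y [a b] h Y0.
rewrite /= sqr_sqrtr ?addr_ge0 ?sqr_ge0//.
move: h; simpc => /andP[_ h].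
rewrite -subr_ge0 -(pmulr_rge0 _ Y0).
nra.
Qed.


(** This shows that a weighted composition operator sends the point mass at [w] to a function
    supported on the fibre over [w], where it equals the weight [c]. *)
Lemma mul_deltaE (c : V -> R[i]) (phi : V -> V) (w v : V) :
  c v * ell2_delta w (phi v) = if v \in phi @^-1` [set w] then c v else 0.
Proof.
rewrite /= -(in_set1 w (phi v)) mulr_natr mulrb.
by congr (if _ then _ else _); apply/idP/idP; rewrite !inE.
Qed.

Lemma hnorm_delta (w : V) : hnorm dot (ell2_delta w) = 1.
Proof.
rewrite hnormE (eq_rsum (b := fun v => if v \in [set w] then 1 else 0)).
  rewrite -rsum_mkcond rsum_ge0; last by move=> *; exact: ler01.
  by rewrite esum_set1 ?lee_fin ?ler01//= sqrtr1.
move=> v _; rewrite in_set1 /ell2_delta [ell2_fun _ _]/=.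
by case: eqP => _; rewrite ?normc1 ?normc0 ?expr1n ?expr0n.
Qed.

(** * Norms and adjoint of a weighted composition operator *)

Section weighted_operator.
Variables (phi : V -> V) (c : V -> R[i]) (T : ell2 R V -> ell2 R V).
Hypothesis TE : forall f v, T f v = c v * f (phi v).

(** The map and the weight are kept general to cover both [W], with [psi] and [u], and its cube,
    with [iter 3 psi] and [u_ u psi 3]. *)
Let weight (w : V) : R := \rsum_(v in phi @^-1` [set w]) normc (c v) ^+ 2.

(** On the fibre over [w], [T f] is [c] times the constant [f w]. *)
Let fibre_norm f (w : V) :
  \rsum_(v in phi @^-1` [set w]) normc (T f v) ^+ 2 =
  weight w * normc (f w) ^+ 2.
Proof.
rewrite /weight mulrC -rsumZ.
apply: eq_rsum => v; rewrite inE /= => vw.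
by rewrite TE normcM exprMn vw mulrC.
Qed.

Lemma rsummable_weighted f :
  rsummable setT (fun w => weight w * normc (f w) ^+ 2).
Proof.
rewrite (_ : (fun w => _) =
    fun w => \rsum_(v in phi @^-1` [set w]) normc (T f v) ^+ 2).
  exact/rsummable_fibre/ell2_rsummable.
by apply/funext => w; rewrite fibre_norm.
Qed.

Lemma sqr_hnorm_weighted f :
  hnorm dot (T f) ^+ 2 = \rsum_(w in setT) weight w * normc (f w) ^+ 2.
Proof.
rewrite sqr_hnorm (rsum_fibre phi); last exact: ell2_rsummable.
by apply: eq_rsum => w _; rewrite fibre_norm.
Qed.

Lemma weighted_dot_delta f (w : V) :
  dot (T f) (T (ell2_delta w)) = (weight w)%:C * f w.
Proof.
rewrite -csumZr csum_mkcond; apply: eq_csum => v _; rewrite !TE mul_deltaE /=.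
case: ifP => [|_]; last by rewrite conjC0 mulr0.
rewrite inE /= => <-.
case: (c v) (f (phi v)) => [a b] [p q]; simpc.
by rewrite sqr_sqrtr ?addr_ge0 ?sqr_ge0//; congr Complex; ring.
Qed.

Section adjoint.
Variable M : R.
Hypothesis TM : forall f, hnorm dot (T f) <= M * hnorm dot f.

Lemma weighted_adjoint_subproof f :
  (fun w => dot f (T (ell2_delta w))) \in @square_summable R V.
Proof.
pose b w := M ^+ 2 * \rsum_(v in phi @^-1` [set w]) normc (f v) ^+ 2.
apply: (@square_summable_le _ b); last first.
  exact/rsummableZ/rsummable_fibre/ell2_rsummable.
move=> w.
(* Applied to [f] itself, Cauchy-Schwarz would give a bound independent of [w], which need not be
   summable. Since [T (ell2_delta w)] vanishes off the fibre, [f] may be replaced by its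
   restriction, and the resulting bounds add up to [M ^+ 2] times the squared norm of [f]. *)
set g := ell2_restrict (phi @^-1` [set w]) f.
have -> : dot f (T (ell2_delta w)) = dot g (T (ell2_delta w)).
  apply: eq_csum => v _; rewrite TE mul_deltaE /=.
  by case: ifP => // _; rewrite conjC0 !mulr0.
apply: (le_trans (ell2_CauchySchwarz _ _)).
rewrite mulrC /b; apply: ler_pM; rewrite ?sqr_ge0//.
  have := TM (ell2_delta w); rewrite hnorm_delta mulr1 => h.
  by rewrite ler_pXn2r// nnegrE ?hnorm_ge0// (le_trans (hnorm_ge0 _) h).
rewrite [leLHS](_ : _ = \rsum_(v in phi @^-1` [set w]) normc (f v) ^+ 2)//.
rewrite sqr_hnorm [RHS]rsum_mkcond.
apply: eq_rsum => v _ /=; case: ifP => // _; by rewrite normc0 expr0n.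
Qed.

Definition weighted_adjoint f : ell2 R V := Ell2 (weighted_adjoint_subproof f).

(** Split the inner product along the fibres of [phi]: over [w], [T f] agrees with
    [f w *: T (ell2_delta w)], so the fibre contributes [f w] times the conjugate of
    [weighted_adjoint g w]. *)
Lemma weighted_adjointP : is_adjoint dot T weighted_adjoint.
Proof.
move=> f g; rewrite [LHS](csum_fibre phi); last exact: ell2_csummable.
apply: eq_csum => w _; transitivity (f w * dot (T (ell2_delta w)) g); last first.
  by congr (_ * _); exact: ell2_dotC.
(* [ell2_dotPl] concerns a combination [a *: x + y]; taking [y = 0] moves the scalar [f w] inside
   the inner product. *)
rewrite -[RHS]addr0 -(linear0l dot g) -ell2_dotPl addr0 csum_mkcond.
apply: eq_csum => v _.
rewrite [ell2_fun (_ *: _) v](_ : _ = f w * T (ell2_delta w) v)//.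
rewrite !TE mul_deltaE; case: ifP => [|_]; last by rewrite mulr0 mul0r.
by rewrite inE /= => <-; rewrite [f _ * _]mulrC.
Qed.

End adjoint.
End weighted_operator.
End ell2_space.

(** Forward, the polynomial is at least [(Num.sqrt c - k * Num.sqrt a) ^+ 2]. Backward, a suitable
    [k] is inserted; [a = 0] is separate, as the polynomial is then affine. *)
Lemma discriminant_le (R : rcfType) (a b c : R) :
  0 <= a -> 0 <= b -> 0 <= c ->
  (b <= Num.sqrt c * Num.sqrt a) <->
  (forall k, 0 <= k -> 0 <= c - 2 * k * b + k ^+ 2 * a).
Proof.
move=> a0 b0 c0; split=> [|h].
  rewrite -{2}(sqr_sqrtr a0) -{2}(sqr_sqrtr c0).
  have := sqrtr_ge0 a; have := sqrtr_ge0 c.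
  move: (Num.sqrt a) (Num.sqrt c) => s t t0 s0 bts k k0.
  have := ler_wpM2l k0 bts; have := sqr_ge0 (t - k * s); nra.
rewrite -sqrtrM// -(ger0_norm b0) -sqrtr_sqr ler_wsqrtr//.
have [a1|a1] := eqVneq a 0.
  have [->|bn0] := eqVneq b 0; first by rewrite expr0n mulr_ge0.
  have bp : 0 < b by rewrite lt_def bn0.
  (* At this [k] the affine function takes the value [- c - 2], which is negative. *)
  have := h ((c + 1) / b) (divr_ge0 (addr_ge0 c0 ler01) b0).
  rewrite a1 mulr0 addr0 -mulrA divfK//; lra.
have ap : 0 < a by rewrite lt_def a1.
(* The minimum is attained at [k = b / a], and [a] times its value is [c * a - b ^+ 2]. *)
have := h (b / a) (divr_ge0 b0 a0).
rewrite -(pmulr_rge0 _ ap).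
rewrite (_ : a * _ = c * a - b ^+ 2) ?subr_ge0//; by field.
Qed.

(** * Equivalence of the three conditions *)

Unset Implicit Arguments.

Theorem theorem4p6 (R : realType) (V : choiceType) (E : V -> V -> Prop)
    (psi : V -> V) (hE : parent_map E psi) (u : V -> R[i])
    (W : {linear ell2 R V -> ell2 R V})
    (hW : weighted_composition u psi W)
    (hWb : bounded_operator (@ell2_dot R V) W) :
  [<->
    quasi_star_paranormal (@ell2_dot R V) W;
    forall f : ell2 R V,
      \rsum_(w in setT)
        (`|\rsum_(v in chi psi w) (normc (u v) ^+ 2)| ^+ 2 * normc (f w) ^+ 2)
      <= Num.sqrt (\rsum_(w in setT)
           (normc (u_ u psi 3 w) ^+ 2 * normc (f (iter 3 psi w)) ^+ 2))
         * Num.sqrt (\rsum_(w in setT)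
           (normc (u_ u psi 1 w) ^+ 2 * normc (f (psi w)) ^+ 2));
    forall (k : R) (f : ell2 R V), 0 <= k ->
      0 <= \rsum_(w in setT)
        (((\rsum_(v in iter_preimage psi 3 w) (normc (u_ u psi 3 v) ^+ 2))
          - 2 * k * (\rsum_(v in iter_preimage psi 1 w) (normc (u v) ^+ 2)) ^+ 2
          + k ^+ 2 * (\rsum_(v in iter_preimage psi 1 w) (normc (u v) ^+ 2)))
         * normc (f w) ^+ 2)
  ].
Proof.
have [M WM] := hWb.
have W1E f v : W f v = u_ u psi 1 v * f (psi v).
  by rewrite hW /u_ big_ord1.
have W3E f v : W (W (W f)) v = u_ u psi 3 v * f (iter 3 psi v).
  by rewrite !hW /u_ !big_ord_recl big_ord0 /= mulr1 !mulrA.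
pose S := weighted_adjoint hW WM.
have SP : is_adjoint (@ell2_dot R V) W S by exact: weighted_adjointP.
pose m1 w := \rsum_(v in psi @^-1` [set w]) normc (u v) ^+ 2.
pose m3 w := \rsum_(v in iter 3 psi @^-1` [set w]) normc (u_ u psi 3 v) ^+ 2.
(* By construction [S (W f) w] is the inner product of [W f] with [W (ell2_delta w)]. *)
have SWE f w : S (W f) w = (m1 w)%:C * f w by exact: weighted_dot_delta.
have SW2 (f : ell2 R V) w : normc (S (W f) w) ^+ 2 = m1 w ^+ 2 * normc (f w) ^+ 2.
  by rewrite SWE normcM exprMn /= expr0n addr0 sqr_sqrtr ?sqr_ge0.
pose nrm := hnorm (@ell2_dot R V).
pose P f := nrm (S (W f)) ^+ 2 <= nrm (W (W (W f))) * nrm (W f).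
(* Uniqueness of the adjoint replaces the existentially quantified one by [S]. *)
have P1 : quasi_star_paranormal (@ell2_dot R V) W <-> forall f, P f.
  split=> [[S' S'P h] f|h]; last by exists S.
  by rewrite /P -(is_adjoint_unique S'P SP); exact: h.
have P2 (f : ell2 R V) : P f <->
    \rsum_(w in setT)
      (`|\rsum_(v in chi psi w) (normc (u v) ^+ 2)| ^+ 2 * normc (f w) ^+ 2)
    <= Num.sqrt (\rsum_(w in setT)
         (normc (u_ u psi 3 w) ^+ 2 * normc (f (iter 3 psi w)) ^+ 2))
       * Num.sqrt (\rsum_(w in setT)
         (normc (u_ u psi 1 w) ^+ 2 * normc (f (psi w)) ^+ 2)).
  rewrite /P /nrm sqr_hnorm !hnormE.
  under [in X in _ <-> X]eq_rsum do rewrite -/(m1 _) real_normK ?num_real// -SW2.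
  under [in X in _ <-> is_true (_ <= Num.sqrt X * _)]eq_rsum
    do rewrite -exprMn -normcM -W3E.
  under [in X in _ <-> is_true (_ <= _ * Num.sqrt X)]eq_rsum
    do rewrite -exprMn -normcM -W1E.
  by [].
have P3 (f : ell2 R V) : P f <-> forall k, 0 <= k ->
    0 <= \rsum_(w in setT)
      ((m3 w - 2 * k * m1 w ^+ 2 + k ^+ 2 * m1 w) * normc (f w) ^+ 2).
  have sumE k : \rsum_(w in setT)
      ((m3 w - 2 * k * m1 w ^+ 2 + k ^+ 2 * m1 w) * normc (f w) ^+ 2) =
      nrm (W (W (W f))) ^+ 2 - 2 * k * nrm (S (W f)) ^+ 2
      + k ^+ 2 * nrm (W f) ^+ 2.
    rewrite /nrm (sqr_hnorm_weighted W3E) (sqr_hnorm_weighted hW) sqr_hnorm.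
    (* Splitting the sum requires each of the three families to be summable; they are so because
       [W f], [S (W f)] and [W (W (W f))] lie in [ell2]. *)
    have s1 := rsummable_weighted hW f; have s3 := rsummable_weighted W3E f.
    have s2 := ell2_rsummable (S (W f)).
    have s2k := rsummableZ (- (2 * k)) s2; have s1k := rsummableZ (k ^+ 2) s1.
    rewrite -mulNr -!rsumZ -(rsumD s3 s2k) -(rsumD (rsummableD s3 s2k) s1k).
    by apply: eq_rsum => w _; rewrite SW2 -/(m1 w) -/(m3 w); ring.
  (* The coefficients are squared norms, so the square roots in [discriminant_le] reduce to the
     norms in [P f]. *)
  have := discriminant_le (sqr_ge0 (nrm (W f)))
    (sqr_ge0 (nrm (S (W f)))) (sqr_ge0 (nrm (W (W (W f))))).
  rewrite !sqrtr_sqr !ger0_norm ?hnorm_ge0// => H.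
  by split=> [/H h k /h|h]; [rewrite sumE|apply/H => k /h; rewrite sumE].
tfae.
- by move=> /P1 h f; apply/P2.
(* The sets [iter_preimage psi n w] in (3) agree by conversion with the preimages in [m1] and
   [m3]. *)
- by move=> h k f; apply: (P3 f).1; apply/P2.
- by move=> h; apply/P1 => f; apply/P3 => k k0; exact: h.
Qed.
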